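(* Suppose we are given an LP $\min\{c^Tx\mid Ax=b,\ x\ge\ell\}$ with $A\in\mathbb{Q}^{m\times n}$, $b\in\mathbb{Q}^m$, $c,\ell\in\mathbb{Q}^n$, fixed constants $C\ge1$, $0<\epsilon<1$, $1<\beta<1/\epsilon$, and a rational limit point $\tilde x\in\mathbb{Q}^n$, $\tilde y\in\mathbb{Q}^m$ with the denominator of each component at most $\tilde q$. Furthermore, suppose a sequence of primal-dual solutions $x_k\in\mathbb{Q}^n$, $y_k\in\mathbb{Q}^m$ and scaling factors $\Delta_k\ge1$, $k=1,2,\ldots$, satisfies $$\|(\tilde x,\tilde y)-(x_k,y_k)\|_\infty\le C\sum_{i=k+1}^\infty\Delta_i^{-1}$$ with $\Delta_1=1$ and $\Delta_k/\Delta_{k+1}\le\epsilon$ for all $k$. Let $M_k:=\sqrt{\Delta_{k+1}/(2\beta^k)}$. Then there exists $K=K(\tilde q,C)\in O(\max\{\langle\tilde q\rangle,\langle C\rangle\})$ such that $$\|(\tilde x,\tilde y)-(x_k,y_k)\|_\infty<\frac{1}{2M_k^2},\qquad 1\le\tilde q\le M_k,$$ holds for all $k\ge K$; i.e., for all such $k$, each component of $\tilde x,\tilde y$ can be reconstructed from the corresponding component $a$ of $x_k,y_k$ in polynomial time, as the unique rational number $r/q$ with $1\le q\le M_k$ and $|r/q-a|<1/(2M_kq)$.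
   Context: Here $\tilde q\ge1$ is an integer and $\|\cdot\|_\infty$ is the maximum norm. Logarithms are base two. Encoding length: $\langle z\rangle:=1+\lceil\log(|z|+1)\rceil$ for $z\in\mathbb{Z}$, and $\langle p/q\rangle:=\langle p\rangle+\langle q\rangle$ for a rational number in lowest terms with $q>0$. Since $\epsilon$ and $\beta$ are fixed constants, the constant in $O(\cdot)$ may depend on $\epsilon$ and $\beta$, but not on the LP, $\tilde q$, $C$, or the sequences. Known fact referred to by ''reconstructed in polynomial time'': for $a\in\mathbb{Q}$ and $M>0$ there exists at most one rational number $r/q$ with $|r/q-a|<1/(2Mq)$ and $1\le q\le M$, and there is an algorithm, polynomial-time in the encoding lengths of $a$ and $M$, that tests whether it exists and, if so, computes it (continued fractions / extended Euclidean algorithm). *)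

(* Defs.v *)
From mathcomp Require Import all_boot all_order all_algebra.
From mathcomp Require Import all_classical all_reals all_analysis.

Set Implicit Arguments.
Unset Strict Implicit.
Unset Printing Implicit Defensive.

Import Order.TTheory GRing.Theory Num.Theory.

Local Open Scope ring_scope.

(* [up_log 2 k] is the ceiling of the base-two logarithm of k for k >= 1. *)
Definition enc_int (z : int) : nat := (1 + up_log 2 (`|z| + 1))%N.

Definition enc_rat (r : rat) : nat := (enc_int (numq r) + enc_int (denq r))%N.

(** ** Polynomial time

Programs over finitely many integer registers.  Each step is charged the
encoding lengths of all the numbers it involves, the result included, so that
running times are polynomially equivalent to bit complexity. *)

Inductive arith := Add | Sub | Mul | Div.

(* [Div] is division rounded as in [intdiv] (the floor of the quotient for a
   positive divisor), with value 0 when the divisor is 0. *)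
Definition arith_op (o : arith) (u v : int) : int :=
  match o with
  | Add => u + v
  | Sub => u - v
  | Mul => u * v
  | Div => (u %/ v)%Z
  end.

Inductive program :=
| Const (d : nat) (z : int)
| Arith (o : arith) (d i j : nat)
| Seq (p1 p2 : program)
| IfPos (i : nat) (p1 p2 : program)
| WhilePos (i : nat) (p : program).

Definition store := nat -> int.

Definition upd (s : store) (d : nat) (z : int) : store :=
  fun i => if i == d then z else s i.

(* [exec p s s' t]: started in s, the program p halts in s' after time t. *)
Inductive exec : program -> store -> store -> nat -> Prop :=
| exec_const d z s :
    exec (Const d z) s (upd s d z) (enc_int z)
| exec_arith o d i j s :
    let z := arith_op o (s i) (s j) in
    exec (Arith o d i j) s (upd s d z)
      (enc_int (s i) + enc_int (s j) + enc_int z)%N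
| exec_seq p1 p2 s1 s2 s3 t1 t2 :
    exec p1 s1 s2 t1 -> exec p2 s2 s3 t2 ->
    exec (Seq p1 p2) s1 s3 (t1 + t2)%N
| exec_if_true i p1 p2 s s' t :
    0 < s i -> exec p1 s s' t ->
    exec (IfPos i p1 p2) s s' (enc_int (s i) + t)%N
| exec_if_false i p1 p2 s s' t :
    s i <= 0 -> exec p2 s s' t ->
    exec (IfPos i p1 p2) s s' (enc_int (s i) + t)%N
| exec_while_true i p s1 s2 s3 t1 t2 :
    0 < s1 i -> exec p s1 s2 t1 -> exec (WhilePos i p) s2 s3 t2 ->
    exec (WhilePos i p) s1 s3 (enc_int (s1 i) + t1 + t2)%N
| exec_while_false i p s :
    s i <= 0 -> exec (WhilePos i p) s s (enc_int (s i)).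

(* The input (a, N) is given in registers 0, 1, 2 as the numerator and
   denominator of a, and N; all other registers start at 0.  The output is read
   off registers 0 and 1 as a fraction in lowest terms. *)
Definition input_store (a : rat) (N : int) : store :=
  fun i => [:: numq a; denq a; N]`_i.

Definition polytime (f : rat -> int -> rat) : Prop :=
  exists (p : program) (T : {poly nat}), forall (a : rat) (N : int),
  exists (s : store) (t : nat),
    [/\ exec p (input_store a N) s t,
        s 0%N = numq (f a N),
        s 1%N = denq (f a N)
      & (t <= T.[enc_rat a + enc_int N])%N].

(** ** Reconstruction *)

Definition max_denom (R : realType) (beta : R) (Delta : nat -> R) (k : nat) : R :=
  Num.sqrt (Delta k.+1 / (2 * beta ^+ k)).

(* x is a rational number p / q, not necessarily in lowest terms, with
   1 <= q <= M and |p / q - a| < 1 / (2 M q). *)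
Definition reconstruction (R : realType) (M : R) (a x : rat) : Prop :=
  exists p q : int,
    [/\ x = p%:~R / q%:~R,
        1 <= (q%:~R : R) <= M
      & `|ratr (x - a)| < (2 * M * q%:~R)^-1].

(* Maximum-norm distance of (x, y) and (x', y'), as an element of R. *)
Definition pd_dist (R : realType) (m n : nat)
    (x : 'cV[rat]_n) (y : 'cV[rat]_m) (x' : 'cV[rat]_n) (y' : 'cV[rat]_m) : R :=
  ratr (mx_norm (col_mx x y - col_mx x' y')).

(* Main.v *)
Require Import Defs.
From mathcomp Require Import all_boot all_order all_algebra.
From mathcomp Require Import all_classical all_reals all_analysis.
From mathcomp Require Import zify ring lra.

(** The scaling factors grow at least like [eps ^- k], so the tail of the series
is at most [(1 - eps)^-1 / Delta k.+1], while the two targets are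
[1 / (2 * M ^+ 2) = beta ^+ k / Delta k.+1] and
[M ^+ 2 >= (eps * beta) ^- k / 2].  Both conclusions thus reduce to exponential
inequalities in k with bases [beta > 1] and [(eps * beta)^-1 > 1]:
[C / (1 - eps) < beta ^+ k] and [2 * qt ^+ 2 <= (eps * beta) ^- k].  A number of
encoding length at most [E.+1] is below [2 ^+ E], so both hold as soon as k is
a suitable constant times the larger encoding length ([pow_thresholds],
[max_denom_bounds]).

Uniqueness of the reconstruction is the usual gap argument: distinct fractions
with denominators q and q' are at least [1 / (q * q')] apart
([reconstruction_inj]).

The algorithm runs the extended Euclidean algorithm on the denominator v of a
and [w = u mod v], where u is the numerator of a, and keeps the last convergent
p1 / q1 of w / v with q1 <= N.  If the expansion is exhausted, p1 / q1 equals
w / v; otherwise the next convergent has denominator greater than N.  In either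
case every fraction r / q with q <= N and [|r / q - w / v| < 1 / (2 N q)] equals
p1 / q1 ([exact_fraction_decides], [next_too_large_decides]).  The product of
the two current remainders halves at each turn, so the number of turns is
linear in the input length, and all numbers that occur have linear length
([euclid_loop_runs], [recon_prog_runs]); hence the running time is at most
quadratic.  Here N is the floor of M: since 1 / (2 M^2) <= 1 / (2 N q)
for q <= N <= M, rounding M down loses nothing. *)

Set Implicit Arguments.
Unset Strict Implicit.
Unset Printing Implicit Defensive.

Import Order.TTheory GRing.Theory Num.Theory.

Local Open Scope ring_scope.

(** * Euclid's algorithm and closest fractions *)


(** The state of the extended Euclidean algorithm on (v, w) with remainders
r0 > r1 and consecutive convergents p0 / q0 and p1 / q1 of w / v.  The matrix
of the convergents maps (r1, r0) to (v, w) and has determinant 1 or -1; this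
form avoids the alternating signs of the errors q * w - p * v.  The bounds by v
keep all entries of the same length as the input. *)
Definition euclid_invariant (v w N r0 r1 q0 q1 p0 p1 : int) : Prop :=
  [/\ [/\ 0 <= r1, r1 < r0, 0 <= q0 & 0 < q1],
      [/\ 0 <= p0, p0 <= v, q0 <= v & 0 <= p1],
      q1 * r0 + q0 * r1 = v /\ p1 * r0 + p0 * r1 = w,
      (p1 * q0 - p0 * q1) ^+ 2 = 1
    & 1 <= N -> q1 <= N].

(** The starting convergents are the formal 1 / 0 and 0 / 1. *)
Lemma euclid_init (v w N : int) : 0 <= w < v -> euclid_invariant v w N v w 0 1 1 0.
Proof. by move=> /andP[w0 wv]; split=> //; split; lia. Qed.

(** The new remainder is less than r1 and r0 >= r1 + (r0 mod r1), whence the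
halving of the product of the two remainders: it is the potential that bounds
the number of turns. *)
Lemma euclid_step (v w N r0 r1 q0 q1 p0 p1 : int) (t := (r0 %/ r1)%Z) :
  euclid_invariant v w N r0 r1 q0 q1 p0 p1 -> w < v -> 0 < r1 ->
  [/\ 1 <= t <= v, 0 < t * q1 + q0 <= v /\ 0 <= t * p1 + p0 <= v,
      0 <= r0 - t * r1 < r1, r1 * (r0 - t * r1) * 2 <= r0 * r1
    & t * q1 + q0 <= N ->
      euclid_invariant v w N r1 (r0 - t * r1) q1 (t * q1 + q0) p1 (t * p1 + p0)].
Proof.
move=> [[r1_ge0 r10 q0_ge0 q1_gt0] [p0_ge0 p0v q0v p1_ge0] [eqv eqw] det1 q1N] wv r1_gt0.
have eqr := divz_eq r0 r1; have r2_ge0 := modz_ge0 r0 (lt0r_neq0 r1_gt0).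
have r21 := ltz_pmod r0 r1_gt0.
rewrite -/t in eqr; set r2 := (r0 %% r1)%Z in eqr r2_ge0 r21.
have eq2 : r0 - t * r1 = r2 by rewrite eqr; ring.
rewrite eq2.
have t_gt0 : 1 <= t by nia.
have eqv2 : (t * q1 + q0) * r1 + q1 * r2 = v by rewrite -eqv eqr; ring.
have eqw2 : (t * p1 + p0) * r1 + p1 * r2 = w by rewrite -eqw eqr; ring.
have q2_gt0 : 0 < t * q1 + q0 by nia.
have q2v : t * q1 + q0 <= v by nia.
have p2_ge0 : 0 <= t * p1 + p0 by nia.
have p2v : t * p1 + p0 <= v by nia.
split.
- by apply/andP; split=> //; nia.
- by rewrite q2_gt0 p2_ge0.
- by rewrite r2_ge0.
- by nia.
move=> q2N; split; [by split; lia|split=> //|by []| |by []].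
- nia.
- nia.
- by rewrite -det1; ring.
Qed.

(** When the remainder r1 vanishes, p1 / q1 = w / v, and r / q within
1 / (2 N q) of it leaves |r q1 - p1 q| < q1 / (2 N) < 1. *)
Lemma exact_fraction_decides (v w N r0 q0 q1 p0 p1 r q : int) :
  euclid_invariant v w N r0 0 q0 q1 p0 p1 -> 1 <= N ->
  `|q * w - r * v| * (2 * N) < v -> r * q1 = p1 * q.
Proof.
move=> [[_ r0_gt0 _ q1_gt0] _ [eqv eqw] _ q1N] N1; have {}q1N := q1N N1.
rewrite -eqv -eqw !mulr0 !addr0 !mulrA -mulrBl normrM (gtr0_norm r0_gt0).
rewrite !(mulrAC _ r0) ltr_pM2r // => H.
by nia.
Qed.

(** Best approximation: write (q, r) in the basis of the convergents
(q1, p1), (q2, p2), which is unimodular.  The coordinates are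
be and - al, so q = q1 * be - q2 * al, and the error |q w - r v| is
|be * r1 + al * r2|, with r1, r2 nonnegative.  As 0 < q < q2, a
nonzero al has the sign of be, so no cancellation occurs and the error is too
large.  Hence al = 0, that is r / q = p1 / q1. *)
Lemma next_too_large_decides (v w N r0 r1 q0 q1 p0 p1 r q : int) (t := (r0 %/ r1)%Z) :
  euclid_invariant v w N r0 r1 q0 q1 p0 p1 -> w < v -> 0 < r1 -> N < t * q1 + q0 -> 1 <= N ->
  0 < q <= N -> `|q * w - r * v| * (2 * N) < v -> r * q1 = p1 * q.
Proof.
move=> eu wv r1_gt0 q2N N1 /andP[q_gt0 qN].
have [_ _ /andP[r2_ge0 _] _ _] := euclid_step eu wv r1_gt0.
case: eu => [[_ _ q0_ge0 q1_gt0] _ [eqv eqw] det1 /(_ N1) q1N].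
rewrite -/t in r2_ge0.
set r2 := r0 - t * r1 in r2_ge0; set q2 := t * q1 + q0 in q2N.
pose p2 := t * p1 + p0; set s := p1 * q0 - p0 * q1 in det1.
have eqv2 : v = q2 * r1 + q1 * r2 by rewrite -eqv /q2 /r2; ring.
have eqw2 : w = p2 * r1 + p1 * r2 by rewrite -eqw /p2 /r2; ring.
pose al := s * (r * q1 - p1 * q); pose be := s * (r * q2 - p2 * q).
(* Cramer's rule for q in the basis of the two convergents. *)
have eqab : q1 * be = q2 * al + q.
  by rewrite -[in RHS](mul1r q) -det1 /al /be /s /q2 /p2; ring.
have s1 : `|s| = 1 by apply/eqP; rewrite -sqrp_eq1 // real_normK ?num_real ?det1.
have -> : `|q * w - r * v| = `|be * r1 + al * r2|.
  rewrite -[LHS]mul1r -s1 -normrM -normrN; congr `|_|.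
  by rewrite eqv2 eqw2 /al /be; ring.
(* With al nonzero, the error times 2 N is at least q2 r1 + q1 r2 = v. *)
move=> H; suff al0 : al = 0.
  by apply/eqP; rewrite -subr_eq0 -normr_eq0 -[X in X == _]mul1r -s1 -normrM -/al al0.
have q2_gt0 : 0 < q2 by lia.
case: (ltgtP al 0) => // al_s; exfalso; move: H; apply/negP; rewrite -leNgt.
- have le_al : q2 * al <= - q2 by rewrite -mulrN1 ler_pM2l //; lia.
  have be_s : be <= -1.
    suff: be < 0 by lia.
    by rewrite -(pmulr_rlt0 _ q1_gt0) eqab; lia.
  have hb : q2 <= - be * (2 * N).
    have h1 : q1 * - be <= N * - be by rewrite ler_wpM2r //; lia.
    have h2 : N * 1 <= N * - be by rewrite ler_wpM2l //; lia.
    by rewrite mulrN in h1; lia.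
  have ha : q1 <= - al * (2 * N).
    have h1 : N * 1 <= N * - al by rewrite ler_wpM2l //; lia.
    by lia.
  apply: (@le_trans _ _ (- (be * r1 + al * r2) * (2 * N))).
    rewrite eqv2.
    have h1 : q2 * r1 <= (- be * (2 * N)) * r1 by rewrite ler_pM2r.
    have h2 : q1 * r2 <= (- al * (2 * N)) * r2 by rewrite ler_wpM2r.
    by apply: le_trans (lerD h1 h2) _; lra.
  by apply: ler_wpM2r; [lia | rewrite -normrN ler_norm].
- have le_al : q2 <= q2 * al by rewrite -[X in X <= _]mulr1 ler_pM2l //; lia.
  have be_s : 1 <= be.
    suff: 0 < be by lia.
    by rewrite -(pmulr_rgt0 _ q1_gt0) eqab; lia.
  have hb : q2 <= be * (2 * N).
    have h1 : q1 * be <= N * be by rewrite ler_wpM2r //; lia.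
    by lia.
  have ha : q1 <= al * (2 * N).
    have h1 : N * 1 <= N * al by rewrite ler_wpM2l //; lia.
    by lia.
  apply: (@le_trans _ _ ((be * r1 + al * r2) * (2 * N))).
    rewrite eqv2.
    have h1 : q2 * r1 <= (be * (2 * N)) * r1 by rewrite ler_pM2r.
    have h2 : q1 * r2 <= (al * (2 * N)) * r2 by rewrite ler_wpM2r.
    by apply: le_trans (lerD h1 h2) _; lra.
  by apply: ler_wpM2r; [lia | rewrite ler_norm].
Qed.


(** * Cost calculus for register programs *)

Definition fits (e : nat) (z : int) : Prop := `|z| < 2 ^+ e.

Lemma fitsP e z : fits e z <-> (enc_int z <= e.+1)%N.
Proof.
rewrite /fits /enc_int add1n ltnS -abszE.
have -> : (2 ^+ e : int) = (2 ^ e)%N by rewrite -natz natrX.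
rewrite ltz_nat addn1; split=> [|H]; first exact: up_log_min.
by apply: leq_trans (up_logP _ (isT : 1 < 2)%N) _; rewrite leq_exp2l.
Qed.

(** The cost n is counted in numbers handled: while all registers fit in e bits,
each number costs at most e.+1, so the time is at most n * e.+1.  Keeping
n apart from e makes the costs of straight-line code plain constants.  A variant
rather than a definition, so that application does not unfold it. *)
Variant runs (e : nat) (p : program) (s s' : store) (n : nat) : Prop :=
  Runs of (forall i, fits e (s i)) ->
    (exists2 t, exec p s s' t & (t <= n * e.+1)%N) /\ forall i, fits e (s' i).

Lemma fits_upd e s d z :
  (forall i, fits e (s i)) -> fits e z -> forall i, fits e (upd s d z i).
Proof. by move=> hs hz i; rewrite /upd; case: eqP. Qed.

Lemma runs_const e d z s : fits e z -> runs e (Const d z) s (upd s d z) 1.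
Proof.
move=> hz; split=> hs; split; last exact: fits_upd.
by exists (enc_int z); [constructor | rewrite mul1n (fitsP _ _).1].
Qed.

(** The value z is a separate variable so that it can be simplified before it
enters the store; nested unsimplified stores would grow exponentially. *)
Lemma runs_arith e o d i j z s : arith_op o (s i) (s j) = z -> fits e z ->
  runs e (Arith o d i j) s (upd s d z) 3.
Proof.
move=> <- hz; split=> hs; split; last exact: fits_upd.
eexists; first exact: exec_arith.
have := (fitsP _ _).1 (hs i); have := (fitsP _ _).1 (hs j); have := (fitsP _ _).1 hz.
lia.
Qed.

Lemma runs_seq e p1 p2 s1 s2 s3 n1 n2 : runs e p1 s1 s2 n1 ->
  runs e p2 s2 s3 n2 -> runs e (Seq p1 p2) s1 s3 (n1 + n2).
Proof.
move=> [h1] [h2]; split=> /h1[[t1 e1 l1] /h2[[t2 e2 l2] hs3]]; split=> //.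
by exists (t1 + t2)%N; [apply: exec_seq e1 e2 | rewrite mulnDl leq_add].
Qed.

Lemma runs_if_true e i p1 p2 s s' n : 0 < s i -> runs e p1 s s' n ->
  runs e (IfPos i p1 p2) s s' (1 + n).
Proof.
move=> si [h]; split=> hs; have [[t ex l] hs'] := h hs; split=> //.
exists (enc_int (s i) + t)%N; first exact: exec_if_true.
by rewrite mulnDl mul1n leq_add // (fitsP _ _).1.
Qed.

Lemma runs_if_false e i p1 p2 s s' n : s i <= 0 -> runs e p2 s s' n ->
  runs e (IfPos i p1 p2) s s' (1 + n).
Proof.
move=> si [h]; split=> hs; have [[t ex l] hs'] := h hs; split=> //.
exists (enc_int (s i) + t)%N; first exact: exec_if_false.
by rewrite mulnDl mul1n leq_add // (fitsP _ _).1.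
Qed.

Lemma runs_while_true e i p s1 s2 s3 n1 n2 : 0 < s1 i -> runs e p s1 s2 n1 ->
  runs e (WhilePos i p) s2 s3 n2 -> runs e (WhilePos i p) s1 s3 (1 + n1 + n2).
Proof.
move=> si [h1] [h2]; split=> hs1; have [[t1 e1 l1] /h2[[t2 e2 l2] hs3]] := h1 hs1; split=> //.
exists (enc_int (s1 i) + t1 + t2)%N; first exact: exec_while_true e1 e2.
by rewrite !mulnDl mul1n !leq_add // (fitsP _ _).1.
Qed.

Lemma runs_while_false e i p s : s i <= 0 -> runs e (WhilePos i p) s s 1.
Proof.
move=> si; split=> hs; split=> //; exists (enc_int (s i)); first exact: exec_while_false.
by rewrite mul1n (fitsP _ _).1.
Qed.

Lemma runs_le e p s s' m n : (m <= n)%N -> runs e p s s' m -> runs e p s s' n.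
Proof.
move=> mn [h]; split=> /h[[t ex l] hs']; split=> //; exists t => //.
by apply: leq_trans l _; rewrite leq_mul2r mn orbT.
Qed.

(** * The reconstruction program *)

Local Notation "p ;; q" := (Seq p q) (at level 60, right associativity).
Local Notation copy d i := (Arith Add d i 12).

(** Registers: 0, 1 hold u, v and then the output; 2 holds N; 3, 4 hold r0, r1;
5, 6 hold q0, q1; 7, 8 hold p0, p1; 9 holds the quotient r0 / r1 (outside the
loop, products); 10 and 13 are scratch; 11 holds the integer part of a; 12
stays 0, so that adding it copies a register. *)
Definition convergent_shift : program :=
  copy 5 6;; copy 6 10;;
  Arith Mul 10 9 8;; Arith Add 10 10 7;; copy 7 8;; copy 8 10;;
  Arith Mul 10 9 4;; Arith Defs.Sub 10 3 10;; copy 3 4;; copy 4 10.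

(** Clearing r1 is the signal to leave the loop: it is done when the next
denominator exceeds N, with p1 / q1 left in place. *)
Definition euclid_body : program :=
  Arith Div 9 3 4;; Arith Mul 10 9 6;; Arith Add 10 10 5;; Arith Defs.Sub 13 10 2;;
  IfPos 13 (Const 4 0) convergent_shift.

(** Reducing modulo v first makes all convergents nonnegative; the integer part
is added back at the end. *)
Definition recon_prog : program :=
  Arith Div 11 0 1;; Arith Mul 9 11 1;; Arith Defs.Sub 4 0 9;; copy 3 1;;
  Const 6 1;; Const 7 1;;
  WhilePos 4 euclid_body;;
  Arith Mul 9 11 6;; Arith Add 0 9 8;; copy 1 6.

Definition euclid_store (v w N : int) (s : store) : Prop :=
  euclid_invariant v w N (s 3%N) (s 4%N) (s 5%N) (s 6%N) (s 7%N) (s 8%N) /\ s 2%N = N /\ s 12%N = 0.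

(** One arithmetic instruction: evaluate the registers read, simplify with the
given register values, and check that the result fits. *)
Ltac step sN s0 :=
  apply: runs_arith;
  [rewrite /upd /= ?(sN, s0, addr0); reflexivity | rewrite /fits; lia].

Lemma euclid_body_stop v w N e s :
  euclid_store v w N s -> w < v -> v + `|N| < 2 ^+ e -> 0 < s 4%N ->
  N < (s 3%N %/ s 4%N)%Z * s 6%N + s 5%N ->
  exists s', [/\ runs e euclid_body s s' 43, s' 4%N = 0, s' 6%N = s 6%N,
    s' 8%N = s 8%N & s' 11%N = s 11%N /\ s' 12%N = 0].
Proof.
move=> [eu [sN s0]] wv vN r1_gt0 q2N.
have [/andP[t1 tv] [/andP[q2_gt0 q2v] /andP[p2_ge0 p2v]] _ _ _] :=
  euclid_step eu wv r1_gt0.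
case: (eu) => [[_ _ q0_ge0 q1_gt0] _ _ _ _].
have tq1_ge0 : 0 <= (s 3%N %/ s 4%N)%Z * s 6%N by rewrite mulr_ge0 //; lia.
eexists; split.
- apply: runs_le (_ : 3 + (3 + (3 + (3 + (1 + 1)))) <= 43)%N _ => //.
  apply: runs_seq; first by step sN s0.
  apply: runs_seq; first by step sN s0.
  apply: runs_seq; first by step sN s0.
  apply: runs_seq; first by step sN s0.
  apply: runs_if_true; first by rewrite /upd /=; lia.
  by apply: runs_const; rewrite /fits; lia.
all: by rewrite /upd /=.
Qed.

Lemma euclid_body_step v w N e s :
  euclid_store v w N s -> w < v -> v + `|N| < 2 ^+ e -> 0 < s 4%N ->
  (s 3%N %/ s 4%N)%Z * s 6%N + s 5%N <= N ->
  exists s', [/\ runs e euclid_body s s' 43, euclid_store v w N s',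
    s' 3%N * s' 4%N * 2 <= s 3%N * s 4%N & s' 11%N = s 11%N].
Proof.
move=> [eu [sN s0]] wv vN r1_gt0 q2N.
have [/andP[t1 tv] [/andP[q2_gt0 q2v] /andP[p2_ge0 p2v]] /andP[r2_ge0 r21] half next] :=
  euclid_step eu wv r1_gt0.
case: (eu) => [[_ r10 q0_ge0 q1_gt0] [p0_ge0 p0v q0v p1_ge0] [eqv eqw] _ _].
have r0v : s 3%N <= v by nia.
have q1v : s 6%N <= v by nia.
have p1v : s 8%N <= v by nia.
have tq1_ge0 : 0 <= (s 3%N %/ s 4%N)%Z * s 6%N by rewrite mulr_ge0 //; lia.
have tp1_ge0 : 0 <= (s 3%N %/ s 4%N)%Z * s 8%N by rewrite mulr_ge0 //; lia.
have tr1_ge0 : 0 <= (s 3%N %/ s 4%N)%Z * s 4%N by rewrite mulr_ge0 //; lia.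
eexists; split.
- apply: runs_le (_ : 3 + (3 + (3 + (3 + (1 +
    (3 + (3 + (3 + (3 + (3 + (3 + (3 + (3 + (3 + 3))))))))))))) <= 43)%N _ => //.
  apply: runs_seq; first by step sN s0.
  apply: runs_seq; first by step sN s0.
  apply: runs_seq; first by step sN s0.
  apply: runs_seq; first by step sN s0.
  apply: runs_if_false; first by rewrite /upd /=; lia.
  by do 9![apply: runs_seq; first by step sN s0]; step sN s0.
all: rewrite /euclid_store /upd /= ?s0 ?addr0 //.
- by split; [exact: next|].
Qed.

(** The last clause is the approximation property r / q = p1 / q1, with
denominators cleared. *)
Definition euclid_output (v w N q1 p1 : int) : Prop :=
  [/\ 0 < q1 <= v, 0 <= p1 <= v, coprimez p1 q1
    & 1 <= N -> forall r q : int, 0 < q <= N ->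
      `|q * w - r * v| * (2 * N) < v -> r * q1 = p1 * q].

Lemma coprime_of_det (p0 q0 p1 q1 : int) :
  (p1 * q0 - p0 * q1) ^+ 2 = 1 -> coprimez p1 q1.
Proof.
move=> det; apply/coprimezP.
set d := p1 * q0 - p0 * q1 in det.
(* The inverse of the determinant d is d itself. *)
exists (d * q0, - (d * p0)) => /=; rewrite -det /d; ring.
Qed.

(** Induction on n, the binary logarithm of the product of the remainders: a
turn costs 44 with the loop test, and the final test costs 1. *)
Lemma euclid_loop_runs v w N e n s :
  euclid_store v w N s -> w < v -> v + `|N| < 2 ^+ e -> s 3%N * s 4%N < 2 ^+ n ->
  exists s', [/\ runs e (WhilePos 4 euclid_body) s s' (44 * n + 1),
    euclid_output v w N (s' 6%N) (s' 8%N), s' 11%N = s 11%N & s' 12%N = 0].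
Proof.
elim: n s => [|n IH] s st wv vN; have [eu [sN s0]] := st => prod.
all: have [[r1_ge0 r10 q0_ge0 q1_gt0] [p0_ge0 p0v q0v p1_ge0] [eqv eqw] det1 _] := eu.
all: have output_if : (1 <= N -> forall r q : int, 0 < q <= N ->
      `|q * w - r * v| * (2 * N) < v -> r * s 6%N = s 8%N * q) ->
      euclid_output v w N (s 6%N) (s 8%N)
  by move=> H; split=> //; [nia|nia|exact: coprime_of_det det1].
all: have exact0 : s 4%N = 0 -> euclid_output v w N (s 6%N) (s 8%N)
  by move=> r1_0; rewrite r1_0 in eu; apply: output_if => N1 r q _;
     exact: exact_fraction_decides eu N1.
all: have halt0 k : s 4%N = 0 ->
    runs e (WhilePos 4 euclid_body) s s (44 * k + 1)
  by move=> r1_0; apply: runs_le (runs_while_false _ _ _); [lia|rewrite r1_0].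
(* A product below 1 forces r1 = 0, since r0 > 0. *)
- have r1_0 : s 4%N = 0 by move: prod; rewrite expr0; nia.
  by exists s; split; [exact: halt0|exact: exact0| |].
have [r1_0|r1_n0] := eqVneq (s 4%N) 0.
  by exists s; split; [exact: halt0|exact: exact0| |].
have r1_gt0 : 0 < s 4%N by lia.
have [q2N|q2N] := lerP ((s 3%N %/ s 4%N)%Z * s 6%N + s 5%N) N.
- have [s1 [run1 st1 half s11]] := euclid_body_step st wv vN r1_gt0 q2N.
  have [|s' [run' out' s'11 s'12]] := IH s1 st1 wv vN.
    by move: prod; rewrite exprS; lia.
  exists s'; split=> //; last by rewrite s'11.
  by apply: runs_le (runs_while_true r1_gt0 run1 run'); lia.
- have [s1 [run1 s14 s16 s18 [s111 s112]]] := euclid_body_stop st wv vN r1_gt0 q2N.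
  exists s1; split=> //; last first.
    by rewrite s16 s18; apply: output_if => N1 r q; exact: (next_too_large_decides eu wv r1_gt0 q2N N1).
  have run0 : runs e (WhilePos 4 euclid_body) s1 s1 1.
    by apply: runs_while_false; rewrite s14.
  by apply: runs_le (runs_while_true r1_gt0 run1 run0); lia.
Qed.

(** The registers need 2 L + 1 bits because of the product of the integer part
and q1; the loop takes at most 2 L turns as r0 * r1 starts below 2 ^ (2 L). *)
Lemma recon_prog_runs (u v N : int) (L : nat) (s : store) :
  0 < v -> fits L u -> fits L v -> fits L N ->
  s 0%N = u -> s 1%N = v -> s 2%N = N -> (forall i, (3 <= i)%N -> s i = 0) ->
  let f := (u %/ v)%Z in
  exists s' p1, [/\ runs (2 * L + 1) recon_prog s s' (88 * L + 24),
    s' 0%N = f * s' 1%N + p1 & euclid_output v (u - f * v) N (s' 1%N) p1].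
Proof.
move=> v_gt0 fu fv fN su sv sN sz f; rewrite /fits in fu fv fN.
have eqf := divz_eq u v; have w_ge0 := modz_ge0 u (lt0r_neq0 v_gt0).
have wv := ltz_pmod u v_gt0; rewrite -/f in eqf.
have eqw : u - f * v = (u %% v)%Z by rewrite {1}eqf; ring.
rewrite -eqw in w_ge0 wv; have {eqw}eqf : f * v = u - (u - f * v) by ring.
set w := u - f * v in w_ge0 wv eqf *.
have fle : `|f| <= `|u| by nia.
have sL : (1 : int) <= 2 ^+ L by rewrite exprn_ege1.
have e2L : 2 ^+ (2 * L + 1) = 2 * (2 ^+ L) * (2 ^+ L) :> int.
  by rewrite mul2n -addnn !exprD expr1; ring.
have big : 2 * 2 ^+ L <= 2 ^+ (2 * L + 1) :> int by rewrite e2L; nia.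
have s0 : s 12%N = 0 by rewrite sz.
pose s1 := upd (upd (upd (upd (upd (upd s 11 f) 9 (f * v)) 4 w) 3 v) 6 1) 7 1.
have st1 : euclid_store v w N s1.
  split; first by rewrite /s1 /upd /= !sz //; apply: euclid_init; rewrite w_ge0.
  by rewrite /s1 /upd /=.
have prod : s1 3%N * s1 4%N < 2 ^+ (2 * L).
  by rewrite /s1 /upd /= mul2n -addnn exprD; nia.
have vN : v + `|N| < 2 ^+ (2 * L + 1) by lia.
have [s2 [run2 out2 s2_11 s2_12]] := euclid_loop_runs st1 wv vN prod.
have [/andP[q_gt0 qv] /andP[p_ge0 pv] _ _] := out2.
have s2f : s2 11%N = f by rewrite s2_11.
have fq : `|f * s2 6%N| <= 2 ^+ L * 2 ^+ L - 2 ^+ L.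
  rewrite normrM (gtr0_norm q_gt0).
  by apply: le_trans (_ : (2 ^+ L - 1) * 2 ^+ L <= _);
    [apply: ler_pM => //; lia | rewrite mulrBl mul1r].
exists (upd (upd (upd s2 9 (f * s2 6%N)) 0 (f * s2 6%N + s2 8%N)) 1 (s2 6%N)), (s2 8%N).
split; [| |by []]; last by rewrite /upd.
apply: runs_le (_ : 3 + (3 + (3 + (3 + (1 + (1 + (44 * (2 * L) + 1 + (3 + (3 + 3)))))))) <= _)%N _.
  by lia.
do 4![apply: runs_seq; first by
  apply: runs_arith; [rewrite /upd /= ?(su, sv, s0, addr0); reflexivity | rewrite /fits; lia]].
do 2![apply: runs_seq; first by apply: runs_const; rewrite /fits; lia].
apply: runs_seq; first exact: run2.
by do 2![apply: runs_seq; first by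
  apply: runs_arith; [rewrite /upd /= ?s2f; reflexivity | rewrite /fits; lia]];
  apply: runs_arith; [rewrite /upd /= s2_12 addr0; reflexivity | rewrite /fits; lia].
Qed.


(** * The reconstruction function *)

Lemma fits_le m n z : (m <= n)%N -> fits m z -> fits n z.
Proof. by move=> mn; rewrite !fitsP => h; apply: leq_trans h _. Qed.

(** The tolerance 1 / (2 N q) of the reconstruction problem, in multiplied-out
form, for q the reduced denominator of y. *)
Definition recovers (a : rat) (N : int) (x : rat) : Prop :=
  1 <= N -> forall y : rat, denq y <= N ->
  `|y - a| * (2 * N%:~R * (denq y)%:~R) < 1 -> x = y.

(** Adding the integer part f translates the fractions approximating w / v to
those approximating a, and keeps numerator and denominator coprime, so the
output is in lowest terms. *)
Lemma euclid_output_recovers (a : rat) (N p q : int) (v := denq a)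
    (f := (numq a %/ v)%Z) :
  euclid_output v (numq a - f * v) N q p ->
  let x := (f * q + p)%:~R / q%:~R in
  [/\ numq x = f * q + p, denq x = q & recovers a N x].
Proof.
move=> [/andP[q_gt0 _] _ cop bst] x.
have cop' : coprime `|f * q + p| `|q|
  by have : coprimez q (f * q + p); [rewrite /coprimez gcdzMDl gcdzC | rewrite coprimez_sym].
split.
- by rewrite /x coprimeq_num // gtr0_sg // mul1r.
- by rewrite /x coprimeq_den // (gt_eqF q_gt0) gtr0_norm.
move=> N1 y yN; have dy := denq_gt0 y; have dv : 0 < v := denq_gt0 a.
rewrite -{1}[y]divq_num_den -[a]divq_num_den -/v => H.
have {}H : `|numq y * v - numq a * denq y| * (2 * N) < v.
  rewrite -(ltr_int rat) !rmorphM /= -[X in _ < X]mul1r -ltr_pdivrMr ?ltr0z //.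
  apply: le_lt_trans H; rewrite intr_norm !(rmorphB, rmorphM) /=.
  have -> : (numq y)%:~R / (denq y)%:~R - (numq a)%:~R / v%:~R =
    ((numq y)%:~R * v%:~R - (numq a)%:~R * (denq y)%:~R) / ((denq y)%:~R * v%:~R) :> rat.
    by field; rewrite !intr_eq0 !gt_eqF.
  have dyv_ge0 : (0 : rat) <= ((denq y)%:~R * v%:~R)^-1.
    by rewrite invr_ge0 mulr_ge0 // ler0z ltW.
  rewrite normrM (ger0_norm dyv_ge0).
  by rewrite le_eqVlt; apply/orP; left; apply/eqP; field; rewrite !intr_eq0 !gt_eqF.
have /(_ _)/= := bst N1 (numq y - f * denq y) (denq y).
rewrite dy yN => /(_ isT); rewrite [X in `|X|](_ : _ = - (numq y * v - numq a * denq y)); last by ring.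
rewrite normrN => /(_ H) eqy.
rewrite /x -[y]divq_num_den; apply/eqP; rewrite eqr_div ?intr_eq0; try lia.
rewrite -!intrM eqr_int; apply/eqP; move: eqy; lia.
Qed.

(** The function is extracted by choice from the outputs of the program: totality
and the recovery property are all that is known about it. *)
Lemma recon_exists : exists recon : rat -> int -> rat,
  polytime recon /\ forall a N, recovers a N (recon a N).
Proof.
(* Cost 88 L + 24, times the 2 L + 2 charged for a number of 2 L + 1 bits. *)
pose T : {poly nat} := (88%:P * 'X + 24%:P) * (2%:P * 'X + 2%:P).
suff /choice[g gP] : forall aN : rat * int, exists x, (exists s t,
    [/\ exec recon_prog (input_store aN.1 aN.2) s t, s 0%N = numq x,
        s 1%N = denq x & (t <= T.[enc_rat aN.1 + enc_int aN.2])%N]) /\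
    recovers aN.1 aN.2 x.
  exists (fun a N => g (a, N)); split; last by move=> a N; case: (gP (a, N)).
  by exists recon_prog, T => a N; case: (gP (a, N)).
move=> [a N] /=; set L := (enc_rat a + enc_int N)%N.
have fL z : (enc_int z <= L)%N -> fits L z by move=> h; apply/fitsP; lia.
have fu : fits L (numq a) by apply: fL; rewrite /L /enc_rat; lia.
have fv : fits L (denq a) by apply: fL; rewrite /L /enc_rat; lia.
have fN : fits L N by apply: fL; rewrite /L; lia.
have [] := recon_prog_runs (s := input_store a N) (denq_gt0 a) fu fv fN erefl erefl erefl.
  by case=> [|[|[|i]]] // _; rewrite /input_store nth_default.
move=> s' [p [[run] s'0 /euclid_output_recovers[nx dx rx]]].
have [i|[t ex tle] _] := run.
  have wk z : fits L z -> fits (2 * L + 1) z by apply: fits_le; lia.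
  case: i => [|[|[|i]]]; rewrite /input_store /=; try exact: wk.
  by rewrite nth_default // /fits normr0 exprn_gt0.
eexists; split; last exact: rx.
exists s', t; split; [exact: ex | exact: etrans s'0 (esym nx) | exact: esym dx | ].
by rewrite /T !hornerE; apply: leq_trans tle _; rewrite /GRing.mul /GRing.add /=; lia.
Qed.


(** * Uniqueness of the reconstruction *)

(** Distinct fractions differ by at least 1 / (q q'), whereas two solutions differ
by less than (1 / q + 1 / q') / (2 M) = (q + q') / (2 M q q') <= 1 / (q q'). *)
Lemma reconstruction_inj (R : realType) (M : R) (a x x' : rat) :
  reconstruction M a x -> reconstruction M a x' -> x = x'.
Proof.
move=> [p [q [-> /andP[q1 qM] d]]] [p' [q' [-> /andP[q'1 q'M] d']]].
have q_gt0 : (0 : R) < q%:~R by apply: lt_le_trans q1.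
have q'_gt0 : (0 : R) < q'%:~R by apply: lt_le_trans q'1.
have M_gt0 : 0 < M by apply: lt_le_trans qM.
move: (q_gt0) (q'_gt0); rewrite !ltr0z => qz q'z.
apply/eqP; rewrite eqr_div ?intr_eq0 ?lt0r_neq0 // -!intrM eqr_int -subr_eq0.
apply/negPn/negP => ne0.
have {ne0} : (1 : R) <= `|(p * q' - p' * q)%:~R|.
  by rewrite -intr_norm ler1z -gtz0_ge1 normr_gt0.
apply/negP; rewrite -ltNge.
rewrite !rmorphB /= in d d'.
have := le_lt_trans (ler_distD (ratr a) (ratr (p%:~R / q%:~R)) (ratr (p'%:~R / q'%:~R)))
  (ltrD d _).
rewrite (distrC (ratr a)) => /(_ _ d').
rewrite !(fmorph_div, ratr_int) /=.
rewrite [X in `|X|](_ : _ = (p * q' - p' * q)%:~R / (q%:~R * q'%:~R)); last first.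
  by rewrite !(rmorphB, rmorphM) /=; field; rewrite !gt_eqF.
rewrite normrM [X in _ * X](gtr0_norm _); last by rewrite invr_gt0 mulr_gt0.
rewrite ltr_pdivrMr ?mulr_gt0 // => h; apply: lt_le_trans h _.
have -> : ((2 * M * q%:~R)^-1 + (2 * M * q'%:~R)^-1) * (q%:~R * q'%:~R)
  = (q%:~R + q'%:~R) / (2 * M) :> R by field; rewrite !gt_eqF.
by rewrite ler_pdivrMr ?mulr_gt0 // mul1r; lra.
Qed.

(** * Growth of the scaling factors *)

Lemma expr_unbounded (R : realType) (b X : R) : 1 < b -> exists n, X <= b ^+ n.
Proof.
move=> b1; have bern n : n%:R * (b - 1) <= b ^+ n.
  elim: n => [|n IH]; first by rewrite mul0r expr0.
  have : 1 <= b ^+ n by rewrite exprn_ege1 // ltW.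
  rewrite exprS -natr1; move: (b ^+ n) IH => z; nra.
exists (Num.bound (`|X| / (b - 1))); apply: le_trans (bern _).
apply: le_trans (ler_norm X) _; rewrite -ler_pdivrMr ?subr_gt0 // ltW //.
by rewrite archi_boundP // divr_ge0 // subr_ge0 ltW.
Qed.

(** The source of the linear dependence of the threshold on encoding lengths:
take c with D <= b ^+ c. *)
Lemma expr_dominates (R : realType) (b D : R) : 1 < b -> 0 <= D ->
  exists c, forall E k, (c * E <= k)%N -> D ^+ E <= b ^+ k.
Proof.
move=> b1 D0; have [c Dc] := expr_unbounded D b1; exists c => E k le.
apply: le_trans (_ : b ^+ (c * E) <= _); last by rewrite ler_eXn2l.
by rewrite exprM lerXn2r ?nnegrE // exprn_ge0 // ltW // (lt_trans _ b1).
Qed.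

(** Since (Delta i.+1)^-1 <= eps * (Delta i)^-1, each term times 1 - eps is at
most (Delta i)^-1 - (Delta i.+1)^-1, and these differences telescope. *)
Lemma tail_sum_le (R : realType) (eps : R) (Delta : nat -> R) (k : nat) :
  0 < eps < 1 -> (forall i, (1 <= i)%N -> 1 <= Delta i) ->
  (forall i, (1 <= i)%N -> Delta i / Delta i.+1 <= eps) ->
  \big[+%R/0]_(k.+1 <= i <oo) (Delta i)^-1 <= (1 - eps)^-1 / Delta k.+1.
Proof.
move=> /andP[eps0 eps1] D1 Drat.
have D_gt0 i : 0 < Delta i.+1 by apply: lt_le_trans (D1 _ _).
have partial n : \sum_(k.+1 <= i < n) (Delta i)^-1 <= (1 - eps)^-1 / Delta k.+1.
  rewrite mulrC ler_pdivlMr ?subr_gt0 //.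
  have [nk|kn] := leqP n k.+1.
    by rewrite big_geq // mul0r invr_ge0 ltW.
  apply: le_trans (_ : (Delta k.+1)^-1 - (Delta n)^-1 <= _); last first.
    by rewrite gerBl invr_ge0; case: n kn => // n _; apply: ltW.
  rewrite -[X in _ <= X]opprB -(telescope_sumr (fun i => (Delta i)^-1)) 1?ltnW // mulr_suml -sumrN.
  rewrite big_nat_cond [X in _ <= X]big_nat_cond; apply: ler_sum => -[|i]; rewrite // andbT => /andP[_ _].
  have := Drat i.+1 isT; rewrite ler_pdivrMr // => h.
  rewrite opprB mulrBr mulr1 lerD2l lerN2 mulrC.
  by rewrite -[X in X <= _](mul1r) ler_pdivrMr // mulrAC ler_pdivlMr // mul1r.
have cv : cvgn (fun n => \sum_(k.+1 <= i < n) (Delta i)^-1).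
  apply: nondecreasing_is_cvgn; last by exists ((1 - eps)^-1 / Delta k.+1) => _ [n _ <-].
  apply/nondecreasing_seqP => n; have [kn|nk] := leqP k.+1 n.
    by rewrite big_nat_recr //= lerDl invr_ge0 ltW //; case: n kn.
  by rewrite !big_geq // ltnW.
by apply: limr_le => //; apply: nearW.
Qed.

Lemma Delta_growth (R : realType) (eps : R) (Delta : nat -> R) (k : nat) :
  0 < eps -> (forall i, (1 <= i)%N -> 1 <= Delta i) -> Delta 1%N = 1 ->
  (forall i, (1 <= i)%N -> Delta i / Delta i.+1 <= eps) ->
  eps ^- k <= Delta k.+1.
Proof.
move=> eps0 D1 D11 Drat; elim: k => [|k IH]; first by rewrite expr0 invr1 D11.
have D_gt0 i : 0 < Delta i.+1 by apply: lt_le_trans (D1 _ _).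
have := Drat k.+1 isT; rewrite ler_pdivrMr // mulrC => h.
rewrite exprSr invfM -[X in _ <= X](mulfK (lt0r_neq0 eps0)) ler_pM2r ?invr_gt0 //.
exact: le_trans h.
Qed.

Lemma entry_le_pd_dist (R : realType) (m n : nat) (x x' : 'cV[rat]_n) (y y' : 'cV[rat]_m) :
  (forall j, `|ratr (x j ord0 - x' j ord0)| <= pd_dist R x y x' y') /\
  (forall i, `|ratr (y i ord0 - y' i ord0)| <= pd_dist R x y x' y').
Proof.
have H i : `|ratr ((col_mx x y - col_mx x' y') i ord0) : R| <= pd_dist R x y x' y'.
  rewrite /pd_dist -ratr_norm ler_rat mx_normrE.
  by apply: le_trans (le_bigmax _ _ (i, ord0)).
split=> j; [have := H (lshift m j) | have := H (rshift n j)];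
  by rewrite !mxE ?(unsplitK (inl j)) ?(unsplitK (inr j)).
Qed.


Lemma rat_lt_pow_enc (C : rat) E : 1 <= C -> (enc_rat C <= E.+1)%N -> C < 2 ^+ E.
Proof.
move=> C1 le; have C0 : 0 < C by apply: lt_le_trans C1.
have : fits E (numq C) by apply/fitsP; apply: leq_trans le; rewrite leq_addr.
rewrite /fits gtr0_norm ?numq_gt0 // -(ltr_int rat) rmorphXn /= => lt.
apply: le_lt_trans lt; rewrite -{1}[C]divq_num_den ler_pdivrMr ?ltr0z //.
by rewrite ler_peMr // ?ler0z ?ler1z -?gtz0_ge1 // numq_ge0 ltW.
Qed.

(** With E = E'.+1 the larger encoding length, C and qt are at most 2 ^+ E', so it
suffices to dominate (2 / (1 - eps)) ^+ E, which exceeds 2 ^+ E' / (1 - eps),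
and 4 ^+ E, which exceeds 2 * (2 ^+ E') ^+ 2. *)
Lemma pow_thresholds (R : realType) (eps beta : R) :
  0 < eps < 1 -> 1 < beta < eps^-1 ->
  exists c : nat, forall (qt : nat) (C : rat) k, 1 <= C ->
    (c * maxn (enc_int qt%:Z) (enc_rat C) <= k)%N ->
    ratr C / (1 - eps) < beta ^+ k /\ 2 * qt%:R ^+ 2 <= (eps * beta) ^- k.
Proof.
move=> /andP[eps0 eps1] /andP[b1 beps].
have b0 : 0 < beta by apply: lt_trans b1.
have g1 : 1 < (eps * beta)^-1.
  by rewrite invf_gt1 ?mulr_gt0 // mulrC -ltr_pdivlMr // div1r.
have e1 : 0 < 1 - eps by rewrite subr_gt0.
have D0 : 0 <= 2 / (1 - eps) by rewrite divr_ge0 // ltW.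
have D2 : 2 <= 2 / (1 - eps) by rewrite ler_pdivlMr //; lra.
have [c1 c1P] := expr_dominates b1 D0; have [c2 c2P] := expr_dominates g1 (ler0n R 4).
exists (maxn c1 c2) => qt C k C1; set E := maxn (enc_int _) _ => le.
have [E' eE] : exists E', E = E'.+1.
  by exists E.-1; rewrite prednK // leq_max.
split.
- have CE : (ratr C : R) < 2 ^+ E'.
    have -> : (2 ^+ E' : R) = ratr (2 ^+ E') by rewrite rmorphXn /= ratr_nat.
    by rewrite ltr_rat; apply: rat_lt_pow_enc => //; rewrite -eE leq_maxr.
  apply: lt_le_trans (_ : (2 / (1 - eps)) ^+ E <= _); last first.
    by apply: c1P; apply: leq_trans le; rewrite leq_mul2r leq_maxl orbT.
  apply: lt_le_trans (_ : 2 ^+ E' / (1 - eps) <= _); first by rewrite ltr_pM2r ?invr_gt0.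
  rewrite eE exprSr mulrA ler_pM2r ?invr_gt0 //.
  apply: le_trans (_ : (2 / (1 - eps)) ^+ E' <= _); first by rewrite lerXn2r ?nnegrE.
  by rewrite ler_peMr ?exprn_ge0 // ler1n.
- have qE : (qt%:R : R) <= 2 ^+ E'.
    have : fits E' qt%:Z by apply/fitsP; rewrite -eE leq_maxl.
    by rewrite /fits ger0_norm // -(ltr_int R) rmorphXn /= => /ltW.
  rewrite -exprVn; apply: le_trans (c2P E k _); last first.
    by apply: leq_trans le; rewrite leq_mul2r leq_maxr orbT.
  have e4 : (4 : R) ^+ E' = 2 ^+ (2 * E') by rewrite exprM; congr (_ ^+ _); ring.
  rewrite eE (exprS 4) e4.
  have : (qt%:R : R) ^+ 2 <= 2 ^+ (2 * E') by rewrite mulnC exprM lerXn2r ?nnegrE ?exprn_ge0.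
  have : 0 <= (2 : R) ^+ (2 * E') by rewrite exprn_ge0.
  by lra.
Qed.

(** Both bounds follow by inserting M ^+ 2 = Delta k.+1 / (2 * beta ^+ k): the first
from the tail estimate, where Delta k.+1 cancels, the second from
Delta k.+1 >= eps ^- k. *)
Lemma max_denom_bounds (R : realType) (eps beta delta : R) (C : rat) (Delta : nat -> R) (k qt : nat) :
  0 < eps < 1 -> 1 < beta -> (1 <= qt)%N ->
  (forall i, (1 <= i)%N -> 1 <= Delta i) -> Delta 1%N = 1 ->
  (forall i, (1 <= i)%N -> Delta i / Delta i.+1 <= eps) ->
  ratr C / (1 - eps) < beta ^+ k -> 2 * qt%:R ^+ 2 <= (eps * beta) ^- k -> 1 <= C ->
  delta <= ratr C * \big[+%R/0]_(k.+1 <= i <oo) (Delta i)^-1 ->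
  let M := max_denom beta Delta k in
  delta < (2 * M ^+ 2)^-1 /\ 1 <= (qt%:R : R) <= M.
Proof.
move=> eps01 b1 qt1 D1 D11 Drat Cb qb C1 dle M.
have [eps0 eps1] := andP eps01.
have b0 : 0 < beta by apply: lt_trans b1.
have bk0 : 0 < beta ^+ k by rewrite exprn_gt0.
have D_gt0 : 0 < Delta k.+1 by apply: lt_le_trans (D1 _ _).
have M2 : M ^+ 2 = Delta k.+1 / (2 * beta ^+ k).
  by rewrite sqr_sqrtr // divr_ge0 ?mulr_ge0 // ltW.
have M0 : 0 <= M by apply: sqrtr_ge0.
split.
- apply: le_lt_trans dle _.
  have -> : (2 * M ^+ 2)^-1 = beta ^+ k / Delta k.+1.
    by rewrite M2; field; rewrite !gt_eqF.
  have C0 : 0 <= (ratr C : R) by rewrite ler0q (le_trans _ C1).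
  apply: le_lt_trans (ler_wpM2l C0 (tail_sum_le k eps01 D1 Drat)) _.
  by rewrite mulrA ltr_pM2r ?invr_gt0.
- rewrite ler1n qt1 /= -(ler_pXn2r (n := 2)) ?nnegrE // M2.
  rewrite ler_pdivlMr ?mulr_gt0 // mulrCA mulrA.
  rewrite -ler_pdivlMr //; apply: le_trans qb _.
  rewrite exprMn invfM ler_pM2r ?invr_gt0 //.
  exact: Delta_growth.
Qed.

(** The error bound 1 / (2 M^2) serves for M and for its floor N alike: the
denominator q of x satisfies q <= N <= M, so 1 / (2 M^2) is at most both
1 / (2 M q) and 1 / (2 N q). *)
Lemma close_implies_recovered (R : realType) (M : R) (qt : nat) (a x : rat) (recon : rat -> int -> rat) :
  (forall a N, recovers a N (recon a N)) ->
  1 <= (qt%:R : R) <= M -> denq x <= qt%:Z ->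
  `|ratr (x - a)| < (2 * M ^+ 2)^-1 ->
  unique (reconstruction M a) x /\ recon a (Num.floor M) = x.
Proof.
move=> rP /andP[qt1 qtM] xq d.
have M1 : 1 <= M by apply: le_trans qtM.
have M0 : 0 < M by apply: lt_le_trans M1.
have q0 : (0 : R) < (denq x)%:~R by rewrite ltr0z.
have qM : (denq x)%:~R <= M by apply: le_trans qtM; rewrite -[X in _ <= X]/((qt%:Z)%:~R) ler_int.
have q1 : 1 <= (denq x)%:~R :> R by rewrite ler1z -gtz0_ge1.
have rec : reconstruction M a x.
  exists (numq x), (denq x); split; rewrite ?divq_num_den ?q1 //.
  apply: lt_le_trans d _; rewrite lef_pV2 ?posrE ?mulr_gt0 ?exprn_gt0 //.
  by rewrite expr2 mulrA ler_pM2l ?mulr_gt0.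
split; first by split=> // x'; apply: reconstruction_inj.
have N1 : 1 <= Num.floor M by rewrite floor_ge_int.
apply: rP => //; first by rewrite floor_ge_int.
rewrite -(ltr_rat R) rmorph1 !rmorphM /= !ratr_int ratr_nat ratr_norm.
have N0 : (0 : R) < (Num.floor M)%:~R by rewrite ltr0z.
have NM : (Num.floor M)%:~R <= M by rewrite floor_le.
rewrite -ltr_pdivlMr ?mulr_gt0 // div1r.
apply: lt_le_trans d _; rewrite lef_pV2 ?posrE ?mulr_gt0 ?exprn_gt0 //.
by rewrite expr2 mulrA; apply: ler_pM => //; rewrite ?ler_pM2l // ?mulr_ge0 // ltW.
Qed.

(** * The theorem *)

Theorem theorem6 (R : realType) :
  exists recon : rat -> int -> rat, polytime recon /\
  forall eps beta : R, 0 < eps < 1 -> 1 < beta < eps^-1 ->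
  exists K : nat -> rat -> nat,
    (exists c : nat, forall (qt : nat) (C : rat), (1 <= qt)%N -> 1 <= C ->
       (K qt C <= c * maxn (enc_int qt%:Z) (enc_rat C))%N) /\
    forall (m n : nat) (A : 'M[rat]_(m, n)) (b : 'cV[rat]_m)
      (c ell : 'cV[rat]_n) (C : rat) (qt : nat)
      (xt : 'cV[rat]_n) (yt : 'cV[rat]_m)
      (x : nat -> 'cV[rat]_n) (y : nat -> 'cV[rat]_m) (Delta : nat -> R),
    1 <= C -> (1 <= qt)%N ->
    (forall j, denq (xt j ord0) <= qt%:Z) ->
    (forall i, denq (yt i ord0) <= qt%:Z) ->
    (forall k, (1 <= k)%N -> 1 <= Delta k) ->
    (forall k, (1 <= k)%N ->
       pd_dist R xt yt (x k) (y k)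
         <= ratr C * \big[+%R/0]_(k.+1 <= i <oo) (Delta i)^-1) ->
    Delta 1%N = 1 ->
    (forall k, (1 <= k)%N -> Delta k / Delta k.+1 <= eps) ->
    forall k, (1 <= k)%N -> (K qt C <= k)%N ->
    let M := max_denom beta Delta k in
    [/\ pd_dist R xt yt (x k) (y k) < (2 * M ^+ 2)^-1,
        1 <= (qt%:R : R) <= M,
        forall j,
          unique (reconstruction M (x k j ord0)) (xt j ord0) /\
          recon (x k j ord0) (Num.floor M) = xt j ord0
      & forall i,
          unique (reconstruction M (y k i ord0)) (yt i ord0) /\
          recon (y k i ord0) (Num.floor M) = yt i ord0].
Proof.
have [recon [poly_recon reconP]] := recon_exists.
exists recon; split=> // eps beta eps01 betaP.
have [c0 c0P] := pow_thresholds eps01 betaP; have [b1 _] := andP betaP.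
exists (fun qt C => c0 * maxn (enc_int qt%:Z) (enc_rat C))%N; split; first by exists c0.
move=> m n A b c ell C qt xt yt x y Delta C1 qt1 xtq ytq D1 dle D11 Drat k k1 Kk M.
have [Cb qb] := c0P _ _ _ C1 Kk.
have [d qtM] := max_denom_bounds eps01 b1 qt1 D1 D11 Drat Cb qb C1 (dle k k1).
have [dx dy] := entry_le_pd_dist R xt (x k) yt (y k).
by split=> // [j|i]; apply: close_implies_recovered qtM _ _ => //; apply: le_lt_trans d.
Qed.
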